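(* Let $k\ge 1$ and let $G$ be a definable group with fsg such that $w_{G,k}^{-1}(1)=\{(x_1,\ldots,x_k)\in G^k:[x_1,\ldots,x_k]=1\}$ is generic in $G^k$. Then $G$ has a definable normal subgroup of finite index which is nilpotent of class at most $k-1$.
   Context: We work in a sufficiently saturated (at least $\aleph_1$-saturated) model $\mathcal M$ of a complete theory with infinite models in a countable language; definable means definable in $\mathcal M$ with parameters; ''small'' means of cardinality less than the degree of saturation of $\mathcal M$; a global type is a complete type over $\mathcal M$. A definable group $G$ has finitely satisfiable generics (fsg) if there are a small model $M_0\preceq\mathcal M$ and a global type $p(x)$ containing the formula defining $G$ such that for every $g\in G$ the translate $g\cdot p(x)$ is finitely satisfiable in $M_0$ (every formula in it is satisfied by a tuple from $M_0$). A definable subset $X$ of a definable group is generic if finitely many left translates of $X$ cover the group and finitely many right translates of $X$ cover the group. Left normed commutators: $[x_1]=x_1$ and $[x_1,\ldots,x_{k+1}]=[[x_1,\ldots,x_k],x_{k+1}]$. Nilpotent of class $0$ means trivial. *)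

(* Defs.v *)
From mathcomp Require Import all_boot.
From mathcomp Require Import boolp classical_sets functions cardinality.

Set Implicit Arguments.
Unset Strict Implicit.
Unset Printing Implicit Defensive.

Local Open Scope classical_set_scope.
Local Open Scope card_scope.
Local Open Scope group_scope.

(** * First-order logic *)

Record language := Language {
  fun_symb : Type;
  rel_symb : Type;
  fun_arity : fun_symb -> nat;
  rel_arity : rel_symb -> nat }.

Definition countable_language (L : language) :=
  countable [set: fun_symb L] /\ countable [set: rel_symb L].

Record structure (L : language) := Structure {
  carrier :> Type;
  carrier_nonempty : inhabited carrier;
  fun_interp : forall f : fun_symb L, ('I_(fun_arity f) -> carrier) -> carrier;
  rel_interp : forall R : rel_symb L, set ('I_(rel_arity R) -> carrier) }.

(** [formula L P n]: the formulas in [n] free variables over [L] enlarged by a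
    constant for each element of [P].  Variables are de Bruijn indices: in the
    body of [fEx] the bound variable is [ord0] and the others are shifted. *)
Inductive term (L : language) (P : Type) (n : nat) : Type :=
| tVar of 'I_n
| tPar of P
| tApp (f : fun_symb L) of ('I_(fun_arity f) -> term L P n).

Inductive formula (L : language) (P : Type) : nat -> Type :=
| fEq n of term L P n & term L P n : formula L P n
| fRel n (R : rel_symb L) of ('I_(rel_arity R) -> term L P n) : formula L P n
| fNeg n of formula L P n : formula L P n
| fAnd n of formula L P n & formula L P n : formula L P n
| fEx n of formula L P n.+1 : formula L P n.

Section Semantics.
Variables (L : language) (M : structure L) (P : Type) (par : P -> M).

Fixpoint eval n (v : 'I_n -> M) (t : term L P n) : M :=
  match t with
  | tVar i => v i
  | tPar a => par a
  | tApp f ts => fun_interp (fun i => eval v (ts i))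
  end.

Definition vcons (x : M) n (v : 'I_n -> M) : 'I_n.+1 -> M :=
  fun i => if unlift ord0 i is Some j then v j else x.

Fixpoint sat n (phi : formula L P n) : ('I_n -> M) -> Prop :=
  match phi with
  | fEq _ t u => fun v => eval v t = eval v u
  | fRel _ R ts => fun v => rel_interp (fun i => eval v (ts i))
  | fNeg _ phi => fun v => ~ sat phi v
  | fAnd _ phi psi => fun v => sat phi v /\ sat psi v
  | fEx _ phi => fun v => exists x : M, sat phi (vcons x v)
  end.

End Semantics.

(** ** Theories *)

Definition sentence (L : language) := formula L void 0.
Definition theory (L : language) := set (sentence L).

(* There is exactly one valuation [v : 'I_0 -> M]. *)
Definition holds L (M : structure L) (phi : sentence L) :=
  forall v : 'I_0 -> M, sat (of_void M) phi v.

Definition model_of L (T : theory L) (M : structure L) :=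
  forall phi, T phi -> holds M phi.

Definition entails L (T : theory L) (phi : sentence L) :=
  forall M : structure L, model_of T M -> holds M phi.

Definition complete_theory L (T : theory L) :=
  (exists M : structure L, model_of T M) /\
  forall phi, entails T phi \/ entails T (fNeg phi).

Definition has_infinite_models L (T : theory L) :=
  exists M : structure L, model_of T M /\ infinite_set [set: M].

(** ** Elementary substructures *)

Definition fun_closed L (M : structure L) (A : set M) :=
  forall (f : fun_symb L) (a : 'I_(fun_arity f) -> M),
    (forall i, A (a i)) -> A (fun_interp a).

Section Substructure.
Variables (L : language) (M : structure L) (A : set M).
Hypotheses (A_neq0 : inhabited A) (A_closed : fun_closed A).

Definition substructure : structure L :=
  @Structure L A A_neq0
    (fun f a => SigSub (mem_set (A_closed (fun i => set_mem (valP (a i))))))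
    (fun R => [set a | rel_interp (fun i => val (a i))]).

End Substructure.

Definition elementary_substructure L (M : structure L) (A : set M) :=
  exists (A_neq0 : inhabited A) (A_closed : fun_closed A),
  forall n (phi : formula L void n)
         (a : 'I_n -> substructure A_neq0 A_closed),
    sat (of_void _) phi a <-> sat (of_void M) phi (fun i => val (a i)).

(** ** Types and saturation *)

Definition finitely_satisfiable L (M : structure L) P (par : P -> M) n
    (p : set (formula L P n)) :=
  forall m (phi : 'I_m -> formula L P n), (forall i, p (phi i)) ->
  exists v : 'I_n -> M, forall i, sat par (phi i) v.

Definition complete_type L (M : structure L) P (par : P -> M) n
    (p : set (formula L P n)) :=
  finitely_satisfiable par p /\ forall phi, p phi \/ p (fNeg phi).

Definition realizes L (M : structure L) P (par : P -> M) n
    (v : 'I_n -> M) (p : set (formula L P n)) :=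
  forall phi, p phi -> sat par phi v.

Definition global_type L (M : structure L) n (p : set (formula L M n)) :=
  complete_type (@id M) p.

(** A cardinal is given by a type [K] of that cardinality. *)
Definition small (K : Type) T (A : set T) :=
  (A #<= [set: K]) /\ ~ ([set: K] #<= A).

Definition saturated (K : Type) L (M : structure L) :=
  forall (A : set M) n (p : set (formula L A n)),
    small K A -> complete_type (fun a : A => val a) p ->
    exists v : 'I_n -> M, realizes (fun a : A => val a) v p.

(** * Definability *)

Definition defines L (M : structure L) n (phi : formula L M n)
    (X : set ('I_n -> M)) :=
  forall v, sat id phi v <-> X v.

Definition vcat (M : Type) m n (u : 'I_m -> M) (v : 'I_n -> M) :
    'I_(m + n) -> M :=
  fun i => match fintype.split i with inl j => u j | inr j => v j end.

(** A definable group: a group whose elements are identified, through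
    [coord], with the elements of a definable subset of [M^dim], in such a way
    that the graph of multiplication is definable. *)
Record definable_group L (M : structure L) := DefinableGroup {
  group_sort :> groupType;
  dim : nat;
  coord : group_sort -> 'I_dim -> M;
  coord_inj : injective coord;
  domain_formula : formula L M dim;
  domain_formulaP : defines domain_formula (range coord);
  mul_formula : formula L M (dim + dim + dim);
  mul_formulaP : defines mul_formula
    [set v | exists a b : group_sort,
       v = vcat (vcat (coord a) (coord b)) (coord (a * b))] }.

Definition definable_subset L (M : structure L) (G : definable_group M)
    (X : set G) :=
  exists phi : formula L M (dim G), defines phi (@coord _ _ G @` X).

(** ** Finitely satisfiable generics *)

(** [g . p] is the set of formulas [phi(x)] such that [phi(g * x)] belongs to
    [p]; here [psi] is (any) formula expressing "[x] is in [G] and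
    [phi(g * x)]". *)
Definition translate L (M : structure L) (G : definable_group M) (g : G)
    (p : set (formula L M (dim G))) : set (formula L M (dim G)) :=
  [set phi | exists2 psi, p psi &
     defines psi (@coord _ _ G @` [set a : G | sat id phi (coord (g * a))])].

Definition finitely_satisfiable_in L (M : structure L) (A : set M) n
    (p : set (formula L M n)) :=
  forall phi, p phi ->
  exists v : 'I_n -> M, (forall i, A (v i)) /\ sat id phi v.

Definition fsg (K : Type) L (M : structure L) (G : definable_group M) :=
  exists (M0 : set M) (p : set (formula L M (dim G))),
    [/\ small K M0, elementary_substructure M0,
        global_type p, p (domain_formula G) &
        forall g : G, finitely_satisfiable_in M0 (translate g p)].

(** * Group theory *)

Section Groups.
Variable G : groupType.

Definition generic (X : set G) :=
  (exists s : seq G, [set: G] = \bigcup_(g in [set` s]) [set g * x | x in X]) /\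
  (exists s : seq G, [set: G] = \bigcup_(g in [set` s]) [set x * g | x in X]).

(* The value on the empty sequence is irrelevant. *)
Definition left_normed_commutator (s : seq G) : G :=
  if s is x :: s' then foldl (fun u y => [~ u, y]) x s' else 1.

Definition subgroup (H : set G) :=
  H 1 /\ forall x y, H x -> H y -> H (x * y^-1).

Definition normal_subgroup (H : set G) :=
  subgroup H /\ forall x g, H x -> H (x ^ g).

Definition finite_index (H : set G) :=
  finite_set [set [set g * h | h in H] | g in [set: G]].

Fixpoint lower_central_series (H : set G) (c : nat) : set G :=
  if c is c'.+1 then
    smallest subgroup
      [set [~ x, y] | x in lower_central_series H c' & y in H]
  else H.

Definition nilpotent_of_class_le (c : nat) (H : set G) :=
  lower_central_series H c = [set 1].

End Groups.

(** The fibre over [1] of the word map [w_{G,k} : G^k -> G]. *)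
Definition commutator_fibre (G : groupType) (k : nat) :
    set {ffun 'I_k -> G} :=
  [set x | left_normed_commutator [seq x i | i : 'I_k] = 1].
Arguments commutator_fibre G k : clear implicits.

(* Main.v *)
Require Import Defs.
From mathcomp Require Import all_boot.
From mathcomp Require Import boolp classical_sets functions cardinality.
From mathcomp Require Import filter.

Local Open Scope classical_set_scope.
Local Open Scope card_scope.
Set Implicit Arguments.
Unset Strict Implicit.
Unset Printing Implicit Defensive.

(** The proof is an induction on [k] for a statement relative to a definable
    normal subgroup [Z] ([nilpotent_mod]): if finitely many left translates of
    [{ a | [a_0, ..., a_k] \in Z }] cover, then some definable normal subgroup
    [N] of finite index has the [k]-th term of its lower central series in [Z].
    Taking [Z = 1], and [k - 1] in place of [k], gives the theorem.  Working
    modulo [Z] replaces quotients of [G], which need not be definable groups on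
    subsets of powers of [M].

    Everything rests on two facts.  A type witnessing fsg picks one piece of
    every finite definable covering of [G], and then all left translates of
    this piece meet the small model [M0] ([fsg_cover]).  By saturation, a
    definable condition on [a] and [m] solvable for every [a] by some [m] in
    [M0] is already solvable with [m] in a fixed finite set ([compactness]).

    For the induction step write [C(c) = { y | [c, y] \in Z }], a subgroup of
    [G].  Fixing the first coordinates of a point of the power of [G], the
    covering says that [G] is a union of cosets [b_i C(c_i)] where each [c_i] is
    the iterated commutator of a translate of these coordinates and the [b_i]
    do not depend on the point.  By [fsg_cover] every coset of some [C(c_i)]
    meets [M0], and by [compactness] one finite set [s], independent of [c],
    meets all those cosets ([uniform_finite_index]).  So some [c_i] lies in the
    definable, conjugation-invariant set [S] of the [c] having a conjugate [c']
    such that [s] meets every coset of [C(c')].  For [c, c'] in [S], if [C(c)]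
    is not contained in [C(c')] then [C(c) \ C(c')] contains a coset of a
    subgroup of finite index, hence meets [M0]; by [compactness] a finite set
    separates the [C(c)] for [c] in [S].  There are therefore finitely many of
    them, and their intersection [N1] is definable, normal and of finite index
    ([finite_index_centralizer]).  The elements centralizing [N1] modulo [Z]
    form a definable normal subgroup [Z'], and finitely many left translates of
    [{ a | [a_0, ..., a_(k-1)] \in Z' }] cover.  If [N2] is obtained from [Z']
    by induction, the intersection of [N1] and [N2] works for [Z].

    Only this step uses fsg: an infinite extraspecial group satisfies the
    covering hypothesis for commuting pairs without being virtually abelian. *)

(** * Substitution in first-order formulas *)

Section Syntax.
Variables (L : language) (M : structure L).

Fixpoint term_params P n (t : term L P n) : set P :=
  match t with
  | tVar _ => set0
  | tPar c => [set c]
  | tApp f ts => \bigcup_i term_params (ts i)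
  end.

Fixpoint params P n (phi : formula L P n) : set P :=
  match phi with
  | fEq _ t u => term_params t `|` term_params u
  | fRel _ R ts => \bigcup_i term_params (ts i)
  | fNeg _ phi => params phi
  | fAnd _ phi psi => params phi `|` params psi
  | fEx _ phi => params phi
  end.

Lemma finite_term_params P n (t : term L P n) : finite_set (term_params t).
Proof.
elim: t => [i|c|f ts IH] /=; [exact: finite_set0|exact: finite_set1|].
by apply: bigcup_finite => // i _; apply: IH.
Qed.

Lemma finite_params P n (phi : formula L P n) : finite_set (params phi).
Proof.
elim: phi => {n} [n t u|n R ts|n phi IH|n phi IH psi IH'|n phi IH] //=.
- by rewrite finite_setU; split; apply: finite_term_params.
- by apply: bigcup_finite => // i _; apply: finite_term_params.
- by rewrite finite_setU.
Qed.

(** The valuation obtained by replacing each variable with a variable or with a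
    parameter; this is the semantic side of substitution. *)
Definition assign P (par : P -> M) m n (s : 'I_n -> 'I_m + P) (v : 'I_m -> M) :
    'I_n -> M :=
  fun j => match s j with inl i => v i | inr c => par c end.

Definition names P Q (par : P -> M) (par' : Q -> M) (B : set P) :=
  forall c, B c -> exists c', par' c' = par c.

Lemma subst_term P Q (par : P -> M) (par' : Q -> M) n (t : term L P n) :
  names par par' (term_params t) -> forall m (s : 'I_n -> 'I_m + Q),
  exists t' : term L Q m, forall v,
    eval par' v t' = eval par (assign par' s v) t.
Proof.
elim: t => [i|c|f ts IH] /= Hc m s.
- by case E: (s i) => [j|c]; [exists (tVar _ _ j)|exists (tPar _ _ c)] => v;
    rewrite /= /assign E.
- have [c' Ec] := Hc c erefl.
  by exists (tPar _ _ c').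
- have /choice[ts' Hts'] : forall i, exists t' : term L Q m, forall v,
      eval par' v t' = eval par (assign par' s v) (ts i).
    by move=> i; apply: IH => c ci; apply: Hc; exists i.
  by exists (tApp ts') => v /=; congr fun_interp; apply/funext => i.
Qed.

Definition lift_assign Q m n (s : 'I_n -> 'I_m + Q) : 'I_n.+1 -> 'I_m.+1 + Q :=
  fun j => if unlift ord0 j is Some i then
             match s i with inl l => inl (lift ord0 l) | inr c => inr c end
           else inl ord0.

Lemma assign_vcons Q (par' : Q -> M) m n (s : 'I_n -> 'I_m + Q) x v :
  assign par' (lift_assign s) (vcons x v) = vcons x (assign par' s v).
Proof.
apply/funext => j; rewrite /assign /lift_assign /vcons.
case: unliftP => [i|] _; last by rewrite unlift_none.
by case: (s i) => // l; rewrite liftK.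
Qed.

(** Renaming, instantiation by constants and change of the parameter set are
    all instances of this one substitution; the condition on parameters is what
    later allows a formula over [M] to be read over a small set. *)
Lemma subst_formula P Q (par : P -> M) (par' : Q -> M) n (phi : formula L P n) :
  names par par' (params phi) -> forall m (s : 'I_n -> 'I_m + Q),
  exists psi : formula L Q m, forall v,
    sat par' psi v <-> sat par phi (assign par' s v).
Proof.
elim: phi => {n} [n t u|n R ts|n phi IH|n phi IH psi IH'|n phi IH] /= Hc m s.
- have [t' Et] := subst_term (fun c h => Hc c (or_introl h)) s.
  have [u' Eu] := subst_term (fun c h => Hc c (or_intror h)) s.
  by exists (fEq t' u') => v /=; rewrite Et Eu.
- have /choice[ts' Hts'] : forall i, exists t' : term L Q m, forall v,
      eval par' v t' = eval par (assign par' s v) (ts i).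
    by move=> i; apply: subst_term => c ci; apply: Hc; exists i.
  exists (fRel ts') => v /=.
  by under eq_fun do rewrite Hts'.
- have [psi E] := IH Hc m s.
  by exists (fNeg psi) => v /=; rewrite E.
- have [t' Et] := IH (fun c h => Hc c (or_introl h)) m s.
  have [u' Eu] := IH' (fun c h => Hc c (or_intror h)) m s.
  by exists (fAnd t' u') => v /=; rewrite Et Eu.
- have [psi E] := IH Hc _ (lift_assign s).
  by exists (fEx psi) => v /=; split=> -[x Hx]; exists x; move: Hx;
    rewrite E assign_vcons.
Qed.

Lemma vcat_vcons x d n (u : 'I_d -> M) (v : 'I_n -> M) :
  vcons x (vcat u v) = vcat (vcons x u) v.
Proof.
apply/funext => j; rewrite /vcons /vcat.
case: (unliftP ord0 j) => [i ->|->].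
- case: (splitP (n := n) i) => [l|l] E; case: splitP => l' E'.
  + rewrite (_ : l' = lift ord0 l) ?liftK //.
    by apply/val_inj; rewrite /= -E' /= E.
  + by move: E' (ltn_ord l); rewrite /= /bump /= add1n addSn E => -[->];
      rewrite ltnNge leq_addr.
  + by move: (ltn_ord l'); rewrite -E' /= E /bump /= add1n ltnS ltnNge leq_addr.
  + by congr v; apply/val_inj; move: E'; rewrite /= E /bump /= add1n addSn =>
      -[/addnI].
- case: splitP => l' E' //.
  by rewrite (_ : l' = ord0) ?unlift_none //; apply/val_inj; rewrite /= -E'.
Qed.

Lemma exists_block P (par : P -> M) d n (phi : formula L P (d + n)) :
  exists psi : formula L P n, forall v,
    sat par psi v <-> exists u : 'I_d -> M, sat par phi (vcat u v).
Proof.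
elim: d phi => [|d IH] phi.
  exists phi => v.
  have E (u : 'I_0 -> M) : vcat u v = v.
    apply/funext => j; rewrite /vcat; case: splitP => [[]//|l El].
    by congr v; apply/val_inj.
  split=> [H|[u]]; last by rewrite E.
  have u : 'I_0 -> M by case.
  by exists u; rewrite E.
have [psi E] := IH (fEx phi).
exists psi => v; rewrite E /=; split=> [[u [x]]|[u]] H.
  by exists (vcons x u); rewrite -vcat_vcons.
exists (fun i => u (lift ord0 i)), (u ord0).
rewrite vcat_vcons; congr sat: H; congr vcat; apply/funext => j.
by rewrite /vcons; case: unliftP => [i|] ->.
Qed.

End Syntax.

(** * Small sets *)

Lemma card_le_inj T U (A : set T) (B : set U) (h : T -> U) :
  (forall x, A x -> B (h x)) -> set_inj A h -> A #<= B.
Proof.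
move=> hAB /inj_card_eq e; rewrite -(card_le_eql e).
by apply: subset_card_le => _ [x /hAB hx <-].
Qed.

Lemma card_le_exists_inj T U (A : set T) (B : set U) : A #<= B ->
  exists2 h : A -> U, (forall x, B (h x)) & injective h.
Proof.
move=> /card_leP[f].
exists (fun x => val (f x)) => [x|x y /val_inj]; first exact: set_valP.
by apply: inj; rewrite inE.
Qed.

(** Hilbert's hotel: shift an infinite sequence of [A] to make room for [B]. *)
Lemma card_le_setU_finite T (A B : set T) :
  infinite_set A -> finite_set B -> A `|` B #<= A.
Proof.
move=> /infiniteP/card_le_exists_inj[f0 f0A f0I] /finite_setP[n Bn].
have [|g gn gI] := @card_le_exists_inj _ _ B `I_n; first by move: Bn; rewrite card_eq_le => /andP[].
pose f i := f0 (SigSub (mem_set (I : [set: nat] i))).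
have fI : injective f by move=> i j /f0I[].
pose h x := if pselect (A x) is left _ then
    if pselect (exists i, x = f i) is left e then f (n + projT1 (cid e)) else x
  else if pselect (B x) is left Bx then f (g (SigSub (mem_set Bx))) else x.
apply: (@card_le_inj _ _ _ _ h) => [x|x y].
  rewrite /h => ABx; case: pselect => [Ax|nAx].
    by case: pselect => [e|//]; exact: f0A.
  by case: pselect => [Bx|nBx]; [exact: f0A|case: ABx].
have g_lt z : g z < n by exact: gn.
rewrite !inE /h => ABx ABy; case: (pselect (A x)) => Ax; case: (pselect (A y)) => Ay.
- case: pselect => [ex|nx]; case: pselect => [ey|ny] //.
  + case: (cid ex) => i /= Ei; case: (cid ey) => j /= Ej.
    by move=> /fI/addnI; rewrite Ei Ej => ->.
  + by move=> E; case: ny; eexists; rewrite -E.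
  + by move=> E; case: nx; eexists; rewrite E.
- case: (pselect (B y)) => [By|nBy]; last by case: ABy.
  case: pselect => [ex|nx]; last by move=> E; case: nx; eexists; exact: E.
  by move=> /fI E; move: (g_lt (SigSub (mem_set By))); rewrite -E ltnNge leq_addr.
- case: pselect => [Bx|nBx]; last by case: ABx.
  case: pselect => [ey|ny]; last by move=> E; case: ny; eexists; rewrite -E.
  by move=> /fI E; move: (g_lt (SigSub (mem_set Bx))); rewrite E ltnNge leq_addr.
- case: (pselect (B x)) => [Bx|nBx]; last by case: ABx.
  case: pselect => [By|nBy]; last by case: ABy.
  by move=> /fI/gI[].
Qed.

(** Adding the finitely many parameters of a formula keeps a set small; when
    [A] is finite this needs the uncountability of the cardinal. *)
Lemma small_setU_finite (K : Type) T (A B : set T) :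
  ~ countable [set: K] -> small K A -> finite_set B -> small K (A `|` B).
Proof.
move=> Kunc [AK KA] finB.
have [finA|infA] := pselect (finite_set A).
  have cAB : countable (A `|` B).
    by apply: finite_set_countable; rewrite finite_setU.
  split; last by move=> /card_le_trans/(_ cAB).
  apply: card_le_trans cAB _; apply/infiniteP.
  by move=> /finite_set_countable.
have le := card_le_setU_finite infA finB.
by split; [apply: card_le_trans le AK | move=> /card_le_trans/(_ le)].
Qed.

(** * Definable relations on a definable group *)

Section Definable.
Local Open Scope group_scope.
Variables (L : language) (M : structure L) (G : definable_group M).
Local Notation d := (dim G).

Lemma assignE P (par : P -> M) m n (s : 'I_n -> 'I_m + P) v j :
  assign par s v j = match s j with inl i => v i | inr c => par c end.
Proof. by []. Qed.

Lemma vcatl (T : Type) m n (u : 'I_m -> T) (v : 'I_n -> T) i :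
  vcat u v (lshift n i) = u i.
Proof. by rewrite /vcat (unsplitK (inl i)). Qed.

Lemma vcatr (T : Type) m n (u : 'I_m -> T) (v : 'I_n -> T) i :
  vcat u v (rshift m i) = v i.
Proof. by rewrite /vcat (unsplitK (inr i)). Qed.

Lemma vcat_inj (T : Type) m n (u u' : 'I_m -> T) (v v' : 'I_n -> T) :
  vcat u v = vcat u' v' -> u = u' /\ v = v'.
Proof.
move=> E; split; apply/funext => i.
  by rewrite -(vcatl u v) E vcatl.
by rewrite -(vcatr u v) E vcatr.
Qed.

Lemma namesT (B : set M) : names id id B.
Proof. by move=> c _; exists c. Qed.

(** The element of [M] denoted by a coordinate of a member of the sequence [a],
    or by a constant. *)
Definition value (a : nat -> G) (z : nat * 'I_d + M) : M :=
  match z with inl it => coord (a it.1) it.2 | inr c => c end.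

(** Relations on [G] of any arity are encoded as sets of infinite sequences
    depending on finitely many terms: renaming of variables is then plain
    composition and no arity has to be tracked. *)
Definition definable_rel (P : set (nat -> G)) :=
  exists n (phi : formula L M n) (e : 'I_n -> nat * 'I_d + M),
    forall a, P a <-> sat id phi (fun j => value a (e j)).

Definition scons (g : G) (a : nat -> G) : nat -> G :=
  fun i => if i is j.+1 then a j else g.

Lemma def_ext P Q : (forall a, P a <-> Q a) -> definable_rel P ->
  definable_rel Q.
Proof. by move=> /predeqP ->. Qed.

Lemma def_subst (f : nat -> nat + G) P : definable_rel P ->
  definable_rel (fun a =>
    P (fun i => match f i with inl j => a j | inr g => g end)).
Proof.
move=> [n [phi [e E]]]; exists n, phi.
exists (fun j => match e j with
  | inl (i, t) => match f i with inl i' => inl (i', t) | inr g => inr (coord g t) end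
  | inr c => inr c end) => a.
rewrite E; suff -> : (fun j => value (fun i => match f i with inl j => a j |
  inr g => g end) (e j)) = (fun j => value a (match e j with
  | inl (i, t) => match f i with inl i' => inl (i', t) | inr g => inr (coord g t) end
  | inr c => inr c end)) by [].
apply/funext => j; case: (e j) => [[i t]|c] //=.
by case: (f i).
Qed.

Lemma def_rename (f : nat -> nat) P : definable_rel P ->
  definable_rel (fun a => P (fun i => a (f i))).
Proof. exact: (def_subst (fun i => inl (f i))). Qed.

Lemma def_not P : definable_rel P -> definable_rel (fun a => ~ P a).
Proof.
by move=> [n [phi [e E]]]; exists n, (fNeg phi), e => a /=; rewrite E.
Qed.

Lemma def_and P Q : definable_rel P -> definable_rel Q ->
  definable_rel (fun a => P a /\ Q a).
Proof.
move=> [n [phi [e E]]] [m [psi [f F]]].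
have [phi' E'] := subst_formula (@namesT (params phi)) (fun j => inl (lshift m j)).
have [psi' F'] := subst_formula (@namesT (params psi)) (fun j => inl (rshift n j)).
exists (n + m)%N, (fAnd phi' psi'), (vcat e f) => a /=; rewrite E F E' F'.
have -> : assign id (fun j => inl (lshift m j)) (fun j => value a (vcat e f j))
  = (fun j => value a (e j)).
  by apply/funext => j; rewrite assignE vcatl.
have -> // : assign id (fun j => inl (rshift n j)) (fun j => value a (vcat e f j))
  = (fun j => value a (f j)).
by apply/funext => j; rewrite assignE vcatr.
Qed.

Lemma def_or P Q : definable_rel P -> definable_rel Q ->
  definable_rel (fun a => P a \/ Q a).
Proof.
move=> dP dQ; apply: (@def_ext (fun a => ~ (~ P a /\ ~ Q a))) => [a|].
  by rewrite not_andP !notK.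
by apply: def_not; apply: def_and; apply: def_not.
Qed.

Lemma def_imply P Q : definable_rel P -> definable_rel Q ->
  definable_rel (fun a => P a -> Q a).
Proof.
move=> dP dQ; apply: (@def_ext (fun a => ~ P a \/ Q a)) => [a|].
  by rewrite implyE.
by apply: def_or => //; apply: def_not.
Qed.

(** In a sequence [b], position [0] holds the quantified element and the others
    are shifted by one; an existential over [G] becomes a block of [dim G]
    existentials over [M] relativized to the domain formula. *)
Lemma def_exists Q :
  definable_rel (fun b => Q (b 0) (fun i => b i.+1)) ->
  definable_rel (fun a => exists g, Q g a).
Proof.
(* the value given to the variables that have become bound *)
have [x0] := carrier_nonempty M.
move=> [n [phi [e E]]].
pose s j : 'I_(d + n) + M :=
  if e j is inl (0, t) then inl (lshift n t) else inl (rshift d j).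
have [dom' D] := subst_formula (@namesT (params (domain_formula G)))
   (fun j => inl (lshift n j)).
have [phi' F] := subst_formula (@namesT (params phi)) s.
have [psi H] := exists_block id (fAnd dom' phi').
exists n, psi, (fun j => match e j with inl (0, t) => inr x0
  | inl (i.+1, t) => inl (i, t) | inr c => inr c end) => a.
set v := (v in sat _ psi v); rewrite H.
have Edom u : assign id (fun j => inl (lshift n j)) (vcat u v) = u.
  by apply/funext => j; rewrite assignE vcatl.
have Es g : assign id s (vcat (coord g) v) = fun j => value (scons g a) (e j).
  apply/funext => j; rewrite assignE /s.
  case Ej: (e j) => [[[|i] t]|c]; first by rewrite vcatl.
    by rewrite vcatr /v Ej.
  by rewrite vcatr /v Ej.
split=> [[g Qg]|[u /= []]].
  exists (coord g) => /=; split.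
    by rewrite D Edom; apply/domain_formulaP; exists g.
  by rewrite F Es -E.
rewrite D Edom => /domain_formulaP[g _ <-].
by rewrite F Es -E => Qg; exists g.
Qed.

Lemma def_forall Q :
  definable_rel (fun b => Q (b 0) (fun i => b i.+1)) ->
  definable_rel (fun a => forall g, Q g a).
Proof.
move=> dQ; apply: (@def_ext (fun a => ~ exists g, ~ Q g a)) => [a|].
  by rewrite -forallNE; split=> H g; move: (H g); rewrite notK.
by apply: def_not; apply: def_exists; apply: def_not.
Qed.

Lemma def_mul_graph i j k : definable_rel (fun a => a i * a j = a k).
Proof.
exists (d + d + d)%N, (mul_formula G), (vcat (vcat (fun t => inl (i, t))
   (fun t => inl (j, t))) (fun t => inl (k, t))) => a.
have -> : (fun l => value a (vcat (vcat (fun t => inl (i, t))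
    (fun t => inl (j, t))) (fun t => inl (k, t)) l)) =
  vcat (vcat (coord (a i)) (coord (a j))) (coord (a k)).
  apply/funext => l; rewrite /vcat; case: fintype.split => // m.
  by case: fintype.split.
rewrite (mul_formulaP _); split=> [E|[x [y]]].
  by exists (a i), (a j); rewrite E.
move=> /vcat_inj[/vcat_inj[/coord_inj-> /coord_inj->]].
by move=> /coord_inj ->.
Qed.

Lemma def_mem_var (X : set G) i : definable_subset X ->
  definable_rel (fun a => X (a i)).
Proof.
move=> [phi D]; exists d, phi, (fun t => inl (i, t)) => a /=.
rewrite (D _); split=> [Xa|[x Xx]]; first by exists (a i).
by move/coord_inj <-.
Qed.

Lemma definable_relP (X : set G) :
  definable_rel (fun a => X (a 0)) -> definable_subset X.
Proof.
move=> [n [phi [e E]]].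
have [phi' E'] := subst_formula (@namesT (params phi)) (fun j => match e j with
  inl (_, t) => inl t | inr c => inr c end).
have Ev x : assign id (fun j => match e j with inl (_, t) => inl t
    | inr c => inr c end) (coord x) = fun j => value (fun _ : nat => x) (e j).
  by apply/funext => j; rewrite assignE; case: (e j) => [[]|].
exists (fAnd (domain_formula G) phi') => v /=.
rewrite (domain_formulaP _) E'; split=> [[[x _ <-]]|[x Xx <-]].
  by rewrite Ev -E => Xx; exists x.
by split; [exists x | rewrite Ev -E].
Qed.

(** A map is definable when its graph is, the value being at position [0]. *)
Definition definable_map (F : (nat -> G) -> G) :=
  definable_rel (fun b => b 0 = F (fun i => b i.+1)).

Lemma def_eq_var i j : definable_rel (fun a => a i = a j).
Proof.
have := def_subst (fun l => nth (inr 1) [:: inl i; inr 1; inl j] l) (def_mul_graph 0 1%N 2).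
by apply: def_ext => a; rewrite mulg1.
Qed.

Lemma map_var i : definable_map (fun a => a i).
Proof. exact: def_eq_var. Qed.

Lemma map_const g : definable_map (fun=> g).
Proof.
exact: (def_subst (fun l => if l is l'.+1 then inr g else inl 0)
  (def_eq_var 0 1%N)).
Qed.

Lemma map_rename (f : nat -> nat) F : definable_map F ->
  definable_map (fun a => F (fun i => a (f i))).
Proof. exact: (@def_rename (fun i => if i is j.+1 then (f j).+1 else 0)). Qed.

Lemma def_app F Q : definable_map F ->
  definable_rel (fun b => Q (b 0) (fun i => b i.+1)) ->
  definable_rel (fun a => Q (F a) a).
Proof.
move=> dF dQ; apply: (@def_ext (fun a => exists g, g = F a /\ Q g a)) => [a|].
  by split=> [[g [->]]|] // QF; exists (F a).
exact/def_exists/def_and.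
Qed.

Lemma map_mul F F' : definable_map F -> definable_map F' ->
  definable_map (fun a => F a * F' a).
Proof.
move=> dF dF'.
apply: (@def_app (fun b => F (fun i => b i.+1))
  (fun g b => b 0 = g * F' (fun i => b i.+1))).
  exact: map_rename.
apply: (@def_app (fun b => F' (fun i => b i.+2)) (fun g b => b 1%N = b 0%N * g)).
  exact: map_rename.
by apply: def_ext (def_mul_graph 1%N 0 2) => a; split.
Qed.

Lemma map_inv F : definable_map F -> definable_map (fun a => (F a)^-1).
Proof.
move=> dF; apply: (@def_app (fun b => F (fun i => b i.+1))
  (fun g b => b 0 = g^-1)); first exact: map_rename.
have := def_subst (fun l => if l is 2 then inr 1 else inl l)
  (def_mul_graph 0 1%N 2).
apply: def_ext => a; split=> [E|/= ->]; last by rewrite mulgV.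
by rewrite (mulg1_eq E).
Qed.

Lemma map_conj F F' : definable_map F -> definable_map F' ->
  definable_map (fun a => F a ^ F' a).
Proof.
move=> dF dF'; apply: (map_mul (map_inv dF')).
exact: map_mul.
Qed.

Lemma map_comm F F' : definable_map F -> definable_map F' ->
  definable_map (fun a => [~ F a, F' a]).
Proof.
move=> dF dF'; apply: (map_mul (map_inv dF)).
exact: map_conj.
Qed.

Lemma def_mem X F : definable_subset X -> definable_map F ->
  definable_rel (fun a => X (F a)).
Proof.
move=> dX dF; apply: (@def_app F (fun g _ => X g)) => //.
exact: def_mem_var.
Qed.

Lemma def_false : definable_rel (fun=> False).
Proof.
apply: def_ext (def_and (def_eq_var 0 0) (def_not (def_eq_var 0 0))) => a.
by split=> // -[].
Qed.

Lemma def_true : definable_rel (fun=> True).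
Proof. exact: def_ext (def_eq_var 0 0). Qed.

Lemma def_exists_seq (T : eqType) (s : seq T) Q : (forall m, definable_rel (Q m)) ->
  definable_rel (fun a => exists2 m, m \in s & Q m a).
Proof.
move=> dQ; elim: s => [|m s IH].
  by apply: def_ext def_false => a; split=> // -[].
apply: def_ext (def_or (dQ m) IH) => a; split=> [[Qm|[m' ms Qm]]|[m']].
- by exists m => //; rewrite mem_head.
- by exists m' => //; rewrite inE ms orbT.
- by rewrite inE => /predU1P[->|ms] Qm; [left|right; exists m'].
Qed.

Lemma def_exists_ord r Q : (forall i : 'I_r, definable_rel (Q i)) ->
  definable_rel (fun a => exists i, Q i a).
Proof.
move=> dQ; apply: def_ext (def_exists_seq (enum 'I_r) dQ) => a.
by split=> [[i _ Qi]|[i Qi]]; exists i; rewrite ?mem_enum.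
Qed.

End Definable.

(** * Compactness and finitely satisfiable generics *)

Section Fsg.
Local Open Scope group_scope.
Variables (L : language) (M : structure L) (G : definable_group M).
Local Notation d := (dim G).

(** The points of [G] with coordinates in [B]. *)
Definition rational (B : set M) : set G :=
  [set m | forall t, B (coord m t)].

Lemma subset_names (A B : set M) :
  B `<=` A -> names (@id M) (fun c : A => val c) B.
Proof. by move=> BA c /BA Ac; exists (SigSub (mem_set Ac)). Qed.

(** Otherwise the sets of sequences avoiding [Q m], for [m] rational over [B],
    generate a proper filter.  The formulas over [B] and the parameters of [Q]
    that hold almost everywhere for an ultrafilter extending it form a complete
    type over a small set; a realization of this type is a sequence with no
    rational solution. *)
Lemma compactness (K : Type) (B : set M) (Q : G -> (nat -> G) -> Prop) :
  ~ countable [set: K] -> saturated K M -> small K B ->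
  definable_rel (fun b => Q (b 0) (fun i => b i.+1)) ->
  (forall a, exists2 m, rational B m & Q m a) ->
  exists s : seq G, forall a, exists2 m, m \in s & Q m a.
Proof.
move=> Kunc Msat smallB [n [phi [e E]]] HQ; apply: contrapT => noS.
have {}noS (s : seq G) : exists a, forall m, m \in s -> ~ Q m a.
  apply: contrapT => ns; apply: noS; exists s => a; apply: contrapT => na.
  by apply: ns; exists a => m ms Qm; apply: na; exists m.
pose avoid (s : seq G) := [set a | forall m, m \in s -> ~ Q m a].
pose F : set_system (nat -> G) := [set Y | exists s, avoid s `<=` Y].
have FP : ProperFilter F.
  split; last split.
  - by move=> [s sub]; have [a /sub] := noS s.
  - by exists [::].
  - move=> Y Z [s sY] [t tZ]; exists (s ++ t) => a ast; split.
      by apply: sY => m ms; apply: ast; rewrite mem_cat ms.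
    by apply: tZ => m mt; apply: ast; rewrite mem_cat mt orbT.
  - by move=> Y Z YZ [s sY]; exists s; apply: subset_trans YZ.
have [U [UU FU]] := ultraFilterLemma FP.
have UP : ProperFilter U by exact: ultra_proper.
(* [Q] depends only on the members [0, ..., N] of the sequence. *)
pose N := \max_(j < n) (if e j is inl (i, _) then i else 0).
have leN j i t : e j = inl (i, t) -> (i <= N)%N.
  by move=> Ej; have := leq_bigmax (F := fun j =>
    (if e j is inl (i, _) then i else 0)) j; rewrite Ej.
pose code i t : 'I_(#|{: 'I_N.+1 * 'I_d}|) := enum_rank (inord i : 'I_N.+1, t).
pose pt (a : nat -> G) (j : 'I_(#|{: 'I_N.+1 * 'I_d}|)) :=
  coord (a (enum_val j).1) (enum_val j).2.
have ptE a i t : (i <= N)%N -> pt a (code i t) = coord (a i) t.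
  by move=> iN; rewrite /pt /code enum_rankK /= inordK.
pose consts := \bigcup_j (if e j is inr c then [set c] else set0).
pose C := params phi `|` params (domain_formula G) `|` consts.
pose A := B `|` C.
have smallA : small K A.
  apply: small_setU_finite => //; rewrite /C !finite_setU.
  split; first by split; apply: finite_params.
  apply: bigcup_finite => // j _.
  by case: (e j) => [it|c]; [exact: finite_set0|exact: finite_set1].
pose p := [set psi : formula L A _ | U [set a | sat (fun c : A => val c) psi (pt a)]].
have p_complete : complete_type (fun c : A => val c) p.
  split=> [m psi Hpsi|psi].
    have /filter_ex[a Ha] : U [set a | forall i, sat (fun c : A => val c) (psi i) (pt a)].
      exact: (@filter_forall _ _ (fun i a => sat _ (psi i) (pt a)) U).
    by exists (pt a).
  have [|] := in_ultra_setVsetC [set a | sat (fun c : A => val c) psi (pt a)] UU.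
    by left.
  by right.
have [v Hv] := Msat A _ p smallA p_complete.
have /choice[a Ha] : forall i, exists g : G, forall t, coord g t = v (code i t).
  move=> i.
  have dsub : params (domain_formula G) `<=` A by move=> c ?; right; left; right.
  have [psi D] := subst_formula (subset_names dsub)
    (fun t => inl (code i t)).
  have : p psi.
    apply: filterE => a; apply/D; apply/domain_formulaP.
    exists (a (inord i : 'I_N.+1)) => //; apply/funext => t.
    by rewrite assignE /pt /code enum_rankK.
  move=> /Hv; rewrite D => /domain_formulaP[g _ Eg]; exists g => t.
  by rewrite Eg.
have [m Bm Qm] := HQ a.
have psub : params phi `<=` A by move=> c ?; right; left; left.
have constA j c : e j = inr c -> A c.
  by move=> Ej; right; right; exists j => //; rewrite Ej.
have /choice[s Hs] : forall j, exists z : 'I_(#|{: 'I_N.+1 * 'I_d}|) + A,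
    forall v b, (forall i t, (i <= N)%N -> v (code i t) = coord (b i) t) ->
    match z with inl l => v l | inr c => val c end = value (scons m b) (e j).
  move=> j; case Ej: (e j) => [[[|i] t]|c].
  - by exists (inr (SigSub (mem_set (or_introl (Bm t) : A _)))).
  - exists (inl (code i t)) => w b; apply.
    by apply: ltnW; apply: leN Ej.
  - by exists (inr (SigSub (mem_set (constA _ _ Ej)))).
have [psi D] := subst_formula (subset_names psub) s.
have Dv w b : (forall i t, (i <= N)%N -> w (code i t) = coord (b i) t) ->
    sat (fun c : A => val c) psi w <-> Q m b.
  move=> wb; rewrite D (E (scons m b)).
  suff -> : assign (fun c : A => val c) s w = fun j => value (scons m b) (e j).
    by [].
  by apply/funext => j; apply: (Hs j w b wb).
have : p (fNeg psi).
  apply: FU; exists [:: m] => b /(_ m); rewrite mem_head => /(_ isT) nQ /=.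
  by rewrite (Dv _ b) // => i t; apply: ptE.
by move=> /Hv; apply; apply/(Dv _ a).
Qed.

(** The type [p] contains one of the [Y i], by completeness.  Then the translate
    of [p] by the inverse of [g] contains [{ m | Y i (g * m) }], which therefore
    has a point in the small model. *)
Lemma fsg_cover (K : Type) : fsg K G -> exists2 B, small K B &
  forall r (Y : 'I_r -> set G), (forall i, definable_subset (Y i)) ->
    (forall g, exists i, Y i g) ->
    exists i, forall g, exists2 m, rational B m & Y i (g * m).
Proof.
move=> [B [p [smallB _ [p_sat p_max] p_dom p_fs]]]; exists B => // r Y dY cov.
have /choice[phi Hphi] := dY.
have [i pi] : exists i, p (phi i).
  apply: contrapT => np.
  have {}np i : p (fNeg (phi i)).
    by case: (p_max (phi i)) => // pi; case: np; exists i.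
  (* a point of [G] outside all the [Y i] *)
  have [|v Hv] := p_sat r.+1 (fun j =>
    if unlift ord0 j is Some i then fNeg (phi i) else domain_formula G).
    by move=> j; case: unliftP.
  have := Hv ord0; rewrite unlift_none => /domain_formulaP[g _ gv].
  have [i Yi] := cov g.
  have := Hv (lift ord0 i); rewrite liftK /=; apply.
  by rewrite (Hphi i v); exists g.
exists i => g.
have dYg : definable_subset [set m | Y i (g * m)].
  apply: definable_relP; apply: (def_mem (F := fun a => g * a 0)) => //.
  by apply: map_mul; [exact: map_const | exact: map_var].
have [psi Hpsi] := dYg.
have [|v [vB]] := p_fs g^-1 psi.
  exists (phi i) => // v; rewrite (Hphi i v); split=> -[a].
    move=> Ya <-; exists a => //=; rewrite (Hpsi _); exists (g^-1 * a) => //=.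
    by rewrite mulVKg.
  move=> /= /Hpsi[b Yb /coord_inj Eb] <-; exists a => //.
  by move: Yb; rewrite /= Eb mulVKg.
by move=> /Hpsi[m Ym mv]; exists m => // t; rewrite mv.
Qed.

End Fsg.

(** * Subgroups, coset coverings and commutators *)

Section Subgroups.
Local Open Scope group_scope.
Variable G : groupType.
Implicit Types (H K Z : set G) (s : seq G).

Lemma subgroupV H x : subgroup H -> H x -> H x^-1.
Proof. by move=> [H1 HB] Hx; rewrite -[x^-1]mul1g; apply: HB. Qed.

Lemma subgroupM H x y : subgroup H -> H x -> H y -> H (x * y).
Proof.
by move=> sH Hx Hy; rewrite -[y]invgK; apply: sH.2 => //; apply: subgroupV.
Qed.

Lemma subgroup_bigcap (F : set (set G)) :
  (forall H, F H -> subgroup H) -> subgroup (\bigcap_(H in F) H).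
Proof.
move=> sF; split=> [H /sF[]//|x y Fx Fy H FH].
by apply: (sF H FH).2; [apply: Fx | apply: Fy].
Qed.

Lemma subgroupI H K : subgroup H -> subgroup K -> subgroup (H `&` K).
Proof. by move=> [H1 HB] [K1 KB]; split=> // x y [? ?] [? ?]; split; auto. Qed.

Lemma normal_subgroupI H K :
  normal_subgroup H -> normal_subgroup K -> normal_subgroup (H `&` K).
Proof.
move=> [sH nH] [sK nK]; split; first exact: subgroupI.
by move=> x g [Hx Kx]; split; auto.
Qed.

Definition translates_cover s (X : set G) :=
  forall x, exists2 m, m \in s & X (m^-1 * x).

Definition finitely_covers X := exists s, translates_cover s X.

Lemma finitely_coversS X Y : X `<=` Y -> finitely_covers X -> finitely_covers Y.
Proof.
by move=> XY [s sX]; exists s => x; have [m ms /XY] := sX x; exists m.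
Qed.

(** A coset of [H] and a coset of [K] are either disjoint or meet in a coset of
    [H `&` K]; [z] chooses a representative of the latter. *)
Lemma finitely_coversI H K : subgroup H -> subgroup K ->
  finitely_covers H -> finitely_covers K -> finitely_covers (H `&` K).
Proof.
move=> sH sK [s Hs] [t Kt].
have /choice[z Hz] : forall mn : G * G, exists z,
    forall x, H (mn.1^-1 * x) -> K (mn.2^-1 * x) ->
      H (mn.1^-1 * z) /\ K (mn.2^-1 * z).
  move=> [m n] /=.
  have [[z [Hz Kz]]|no] := pselect (exists z, H (m^-1 * z) /\ K (n^-1 * z)).
    by exists z.
  by exists 1 => x Hx Kx; case: no; exists x.
exists [seq z mn | mn <- [seq (m, n) | m <- s, n <- t]] => x.
have [m ms Hx] := Hs x; have [n nt Kx] := Kt x.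
have [Hz' Kz'] := Hz (m, n) x Hx Kx.
exists (z (m, n)); first by apply: map_f; apply: allpairs_f.
have quot k : (z (m, n))^-1 * x = (k^-1 * z (m, n))^-1 * (k^-1 * x).
  by rewrite invgM invgK -mulgA mulVKg.
split; [rewrite (quot m)|rewrite (quot n)]; apply: subgroupM => //;
  exact: subgroupV.
Qed.

(** If [s] separates the members of [F], there are at most [2 ^ size s] of them.
    The induction splits [F] according to membership of the first element of
    [s], which then no longer separates anything within either half. *)
Lemma finitely_covers_bigcap s (F : set (set G)) :
  (forall H, F H -> subgroup H /\ finitely_covers H) ->
  (forall H K, F H -> F K -> ~ (H `<=` K) ->
     exists2 m, m \in s & H m /\ ~ K m) ->
  finitely_covers (\bigcap_(H in F) H).
Proof.
elim: s F => [|m s IH] F Fok sep.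
  have [[H FH]|noH] := pselect (F !=set0).
    apply: finitely_coversS (Fok H FH).2 => x Hx K FK.
    by apply: contrapT => nKx; have [|//] := sep H K FH FK; move/(_ x Hx).
  by exists [:: 1] => x; exists 1; rewrite ?mem_head // => H FH; case: noH; exists H.
pose F1 := F `&` [set H | H m]; pose F2 := F `&` [set H | ~ H m].
have cF1 : finitely_covers (\bigcap_(H in F1) H).
  apply: IH => [H [/Fok]//|H K [FH Hm] [FK Km] /(sep _ _ FH FK)[m']].
  rewrite inE => /predU1P[->|m's]; [by case=> _ /(_ Km)|by exists m'].
have cF2 : finitely_covers (\bigcap_(H in F2) H).
  apply: IH => [H [/Fok]//|H K [FH Hm] [FK Km] /(sep _ _ FH FK)[m']].
  rewrite inE => /predU1P[->|m's]; [by case=> /Hm|by exists m'].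
have sF1 : subgroup (\bigcap_(H in F1) H).
  by apply: subgroup_bigcap => H [/Fok[]].
have sF2 : subgroup (\bigcap_(H in F2) H).
  by apply: subgroup_bigcap => H [/Fok[]].
apply: finitely_coversS (finitely_coversI sF1 sF2 cF1 cF2) => x [x1 x2] H FH.
by have [Hm|nHm] := pselect (H m); [apply: x1|apply: x2].
Qed.

Lemma finitely_covers_index H : finitely_covers H -> subgroup H -> finite_index H.
Proof.
move=> [s Hs] sH.
apply: (@sub_finite_set _ _ [set [set g * h | h in H] | g in [set` s]]).
  move=> _ [g _ <-]; have [m ms Hm] := Hs g; exists m => //.
  apply/seteqP; split=> _ [h Hh <-].
    exists (g^-1 * m * h); last by rewrite !mulgA mulgV mul1g.
    by apply: subgroupM => //; rewrite -[m]invgK -invgM; apply: subgroupV.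
  exists (m^-1 * g * h); first exact: subgroupM.
  by rewrite !mulgA mulgV mul1g.
by apply: finite_image; apply: finite_seq.
Qed.

(** The preimage of the centralizer of the image of [c] in [G / Z]. *)
Definition centralizer_mod Z c : set G := [set y | Z [~ c, y]].

Lemma commMr (c x y : G) : [~ c, x * y] = [~ c, y] * [~ c, x] ^ y.
Proof. by rewrite /commg /conjg !gnorm. Qed.

Lemma commMl (x y c : G) : [~ x * y, c] = [~ x, c] ^ y * [~ y, c].
Proof. by rewrite /commg /conjg !gnorm. Qed.

Lemma commVr (c x : G) : [~ c, x^-1] = ([~ c, x] ^ x^-1)^-1.
Proof. by apply/eqP; rewrite -mulg_eq1 -commMr mulgV commg1. Qed.

Lemma commVl (c x : G) : [~ x^-1, c] = ([~ x, c] ^ x^-1)^-1.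
Proof. by apply/esym/mulg1_eq; rewrite -commMl mulgV comm1g. Qed.

Lemma subgroup_centralizer_mod Z c :
  normal_subgroup Z -> subgroup (centralizer_mod Z c).
Proof.
move=> [sZ nZ]; split=> [|x y Zx Zy]; rewrite /centralizer_mod /=.
  by rewrite commg1; case: sZ.
rewrite commMr commVr; apply: subgroupM => //; last exact: nZ.
by apply: subgroupV => //; apply: nZ.
Qed.

(** The preimage of the centralizer of the image of [H] in [G / Z]. *)
Definition left_centralizer_mod Z H : set G :=
  [set c | forall y, H y -> Z [~ c, y]].

Lemma normal_left_centralizer_mod Z H : normal_subgroup Z ->
  normal_subgroup H -> normal_subgroup (left_centralizer_mod Z H).
Proof.
move=> [sZ nZ] [sH nH]; split; first split.
- by move=> y _; rewrite comm1g; case: sZ.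
- move=> c c' Zc Zc' y Hy; rewrite commMl commVl.
  apply: subgroupM => //; first by apply: nZ; apply: Zc.
  by apply: subgroupV => //; apply: nZ; apply: Zc'.
- move=> c g Zc y Hy; rewrite -[y](conjgKV g) -conjRg.
  by apply: nZ; apply: Zc; apply: nH.
Qed.

Lemma subset_lcs H K c : H `<=` K ->
  lower_central_series H c `<=` lower_central_series K c.
Proof.
move=> HK; elim: c => //= c IH x Hx K' [sK' K'c]; apply: Hx; split=> //.
by move=> _ [u Hu [y Hy <-]]; apply: K'c; exists u; [exact: IH|exists y; auto].
Qed.

(** Indexing by infinite sequences lets the length vary in the induction;
    [iter_comm a k] has [k.+1] entries. *)
Fixpoint iter_comm (a : nat -> G) k : G :=
  if k is k'.+1 then [~ iter_comm a k', a k'.+1] else a 0.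

Lemma eq_iter_comm a b k : (forall i, (i <= k)%N -> a i = b i) ->
  iter_comm a k = iter_comm b k.
Proof.
elim: k => [|k IH] ab /=; first exact: ab.
by rewrite IH ?ab // => i ik; apply: ab; apply: leqW.
Qed.

Lemma left_normed_commutatorE k (x : {ffun 'I_k.+1 -> G}) (a : nat -> G) :
  (forall i : 'I_k.+1, a i = x i) ->
  left_normed_commutator [seq x i | i : 'I_k.+1] = iter_comm a k.
Proof.
move=> ax.
have -> : [seq x i | i : 'I_k.+1] = map a (iota 0 k.+1).
  rewrite -val_enum_ord -map_comp; apply: eq_map => i /=.
  by rewrite ax.
rewrite /=; elim: k {x ax} => // k IH.
have -> : iota 1 k.+1 = rcons (iota 1 k) k.+1.
  by rewrite -[k.+1 in LHS]addn1 iotaD cats1 add1n.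
by rewrite map_rcons foldl_rcons IH.
Qed.

End Subgroups.

(** * Virtual nilpotency modulo a normal subgroup *)

Section Nilpotent.
Local Open Scope group_scope.
Variables (L : language) (M : structure L) (K : Type) (G : definable_group M).
Hypotheses (K_unc : ~ countable [set: K]) (M_sat : saturated K M).
Hypothesis G_fsg : fsg K G.

(** Proves that a group word in the members of the sequence is definable.
    Commutators and conjugates come first since they unfold to products. *)
Ltac solve_map :=
  by do ?[apply: map_comm|apply: map_conj|apply: map_inv|apply: map_mul
         |exact: map_var|exact: map_const].

(** A piece [b i * C(c i)] picked by [fsg_cover] has all its translates meeting
    the small model, so all cosets of [C(c i)] do.  This replaces Neumann's
    lemma on coverings by cosets, and compactness makes the representatives
    independent of [c]. *)
Lemma uniform_finite_index (Z : set G) r (b : 'I_r -> G) :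
  definable_subset Z -> normal_subgroup Z ->
  exists s : seq G, forall c : nat -> G,
    (forall y, exists i : 'I_r, Z [~ c i, (b i)^-1 * y]) ->
    exists i : 'I_r, translates_cover s (centralizer_mod Z (c i)).
Proof.
move=> dZ nZ; have [B smallB cov] := fsg_cover G_fsg.
have sC c := subgroup_centralizer_mod c nZ.
(* The members [r + i] of the sequence are the points whose cosets have to be
   met: a failure for every [i] is a single sequence without solution. *)
pose Q m (a : nat -> G) :=
  (forall y, exists i : 'I_r, Z [~ a i, (b i)^-1 * y]) ->
  exists i : 'I_r, Z [~ a i, m^-1 * a (r + i)%N].
have [||s Hs] := compactness (Q := Q) K_unc M_sat smallB.
- apply: def_imply.
    apply: def_forall; apply: def_exists_ord => i; apply: def_mem => //.
    solve_map.
  apply: def_exists_ord => i; apply: def_mem => //.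
  solve_map.
- move=> a.
  have [ca|nca] := pselect (forall y, exists i : 'I_r, Z [~ a i, (b i)^-1 * y]).
    have [i|//|i Hi] := cov r (fun i => [set y | Z [~ a i, (b i)^-1 * y]]).
      apply: definable_relP.
      apply: (def_mem (F := fun y => [~ a i, (b i)^-1 * y 0])) => //.
      solve_map.
    have [m Bm Zm] := Hi (b i * (a (r + i)%N)^-1).
    exists m => // _; exists i.
    have := subgroupV (sC _) Zm.
    by rewrite /centralizer_mod /= -mulgA mulKg invgM invgK.
  have [i|g|i /(_ 1)[m Bm _]] := cov 1%N (fun=> setT); last by exists m.
    exact/definable_relP/def_true.
  by exists ord0.
exists s => c cc; apply: contrapT => nc.
have /choice[x Hx] : forall i : 'I_r, exists x,
    forall m, m \in s -> ~ Z [~ c i, m^-1 * x].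
  move=> i; apply: contrapT => nx; apply: nc; exists i => x.
  apply: contrapT => nm; apply: nx; exists x => m ms Zm.
  by apply: nm; exists m.
pose a j := if insub j is Some i then c (i : 'I_r) else
  if insub (j - r)%N is Some i then x i else 1.
have aE (i : 'I_r) : a i = c i by rewrite /a valK.
have aE' (i : 'I_r) : a (r + i)%N = x i.
  by rewrite /a insubF ?addKn ?valK // ltnNge leq_addr.
have [m ms] := Hs a; case=> [y|i].
  by have [i Zi] := cc y; exists i; rewrite aE.
by rewrite aE aE'; apply: Hx.
Qed.

(** The centralizers of uniformly finite index are finitely many, because the
    small model meets every nonempty difference of two of them; their
    intersection [N] is the required subgroup. *)
Lemma finite_index_centralizer (Z : set G) r (b : 'I_r -> G) :
  definable_subset Z -> normal_subgroup Z ->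
  exists N : set G, [/\ definable_subset N, normal_subgroup N,
    finitely_covers N &
    forall c : nat -> G,
    (forall y, exists i : 'I_r, Z [~ c i, (b i)^-1 * y]) ->
    exists i : 'I_r, left_centralizer_mod Z N (c i)].
Proof.
move=> dZ nZ; have [s Hs] := uniform_finite_index b dZ nZ.
have [B smallB cov] := fsg_cover G_fsg.
have sC c := subgroup_centralizer_mod c nZ.
(* Closing under conjugation makes [N] normal. *)
pose S := [set c | exists g, translates_cover s (centralizer_mod Z (c ^ g))].
pose N := [set y | forall c, S c -> Z [~ c, y]].
have dS : definable_subset S.
  apply: definable_relP; apply: def_exists; apply: def_forall.
  apply: def_exists_seq => m; apply: def_mem => //.
  solve_map.
have dN : definable_subset N.
  apply: definable_relP; apply: def_forall; apply: def_imply.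
    by apply: def_mem => //; solve_map.
  by apply: def_mem => //; solve_map.
have S_conj c g : S c -> S (c ^ g).
  by move=> [h Hh]; exists (g^-1 * h); rewrite conjgM conjgK.
have S_cov c : S c -> finitely_covers (centralizer_mod Z c).
  move=> [g Hg]; exists [seq m ^ g^-1 | m <- s] => x.
  have [m ms Zm] := Hg (x ^ g); exists (m ^ g^-1); first exact: map_f.
  have := nZ.2 [~ c ^ g, m^-1 * x ^ g] g^-1 Zm.
  by rewrite conjRg [(m^-1 * _) ^ _]conjMg conjVg !conjgK.
pose Q m (a : nat -> G) := S (a 0) -> S (a 1%N) ->
  (exists y, Z [~ a 0, y] /\ ~ Z [~ a 1%N, y]) ->
  Z [~ a 0, m] /\ ~ Z [~ a 1%N, m].
have [||t Ht] := compactness (Q := Q) K_unc M_sat smallB.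
- apply: def_imply; first by apply: def_mem => //; solve_map.
  apply: def_imply; first by apply: def_mem => //; solve_map.
  apply: def_imply.
    apply: def_exists; apply: def_and; last apply: def_not;
    by apply: def_mem => //; solve_map.
  apply: def_and; last apply: def_not;
    by apply: def_mem => //; solve_map.
- move=> a.
  pose X := [set y | Z [~ a 0, y] /\ ~ Z [~ a 1%N, y]].
  have dX : definable_subset X.
    apply: definable_relP; apply: def_and; last apply: def_not.
      by apply: (def_mem (F := fun y => [~ a 0, y 0])) => //; solve_map.
    by apply: (def_mem (F := fun y => [~ a 1%N, y 0])) => //; solve_map.
  have [[S0 S1 [y [y0 y1]]]|no] := pselect [/\ S (a 0), S (a 1%N) & X !=set0].
    have [u Hu] := finitely_coversI (sC _) (sC _) (S_cov _ S0) (S_cov _ S1).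
    (* [X] contains the coset of [y] modulo the intersection of both subgroups,
       finitely many translates of which cover [G]. *)
    pose Y (i : 'I_(size u)) := [set x | X (y * (nth 1 u i)^-1 * x)].
    have [i|x|i Hi] := cov _ Y.
    + apply: definable_relP.
      apply: (def_mem (F := fun x => y * (nth 1 u i)^-1 * x 0)) => //.
      solve_map.
    + have [m mu [m0 m1]] := Hu x.
      have mi : (index m u < size u)%N by rewrite index_mem.
      exists (Ordinal mi); rewrite /Y /= nth_index // -mulgA; split.
        exact: (subgroupM (sC _)).
      move=> ym; apply: y1.
      rewrite -[y](mulgK (m^-1 * x)).
      by apply: (subgroupM (sC _) ym); apply: subgroupV.
    + have [m Bm Xm] := Hi (y * (nth 1 u i)^-1)^-1.
      by exists m => // _ _ _; move: Xm; rewrite /Y /= mulVKg.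
  have [i|g|i /(_ 1)[m Bm _]] := cov 1%N (fun=> setT).
  + exact/definable_relP/def_true.
  + by exists ord0.
  + exists m => // S0 S1 [y Xy]; case: no; split=> //.
    by exists y.
have NE : N = \bigcap_(H in [set centralizer_mod Z c | c in S]) H.
  apply/seteqP; split=> [y Ny _ [c Sc <-]|y Hy c Sc]; first exact: Ny.
  by apply: (Hy (centralizer_mod Z c)); exists c.
exists N; split=> //.
- split; first by rewrite NE; apply: subgroup_bigcap => _ [c _ <-].
  move=> y g Ny c Sc; rewrite -[c](conjgKV g) -conjRg.
  by apply: nZ.2; apply: Ny; apply: S_conj.
- rewrite NE; apply: (finitely_covers_bigcap (s := t)).
    by move=> _ [c Sc <-]; split; [|exact: S_cov].
  move=> _ _ [c Sc <-] [c' Sc' <-] ncc'.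
  have [m mt Qm] := Ht (fun i => if i is 0 then c else c').
  exists m => //; apply: Qm => //.
  apply: contrapT => no; apply: ncc' => y Zy; apply: contrapT => nZy.
  by apply: no; exists y.
- move=> c /Hs[i Hi]; exists i => y Ny; apply: Ny.
  by exists 1; rewrite conjg1.
Qed.

(** The index [k] counts commutator operations, so the words have [k.+1]
    entries.  The base case is that [Z] itself has finite index. *)
Lemma nilpotent_mod k (Z : set G) : definable_subset Z -> normal_subgroup Z ->
  (exists r (g : 'I_r -> nat -> G), forall a, exists i,
     Z (iter_comm (fun j => (g i j)^-1 * a j) k)) ->
  exists N : set G, [/\ definable_subset N, normal_subgroup N,
    finitely_covers N & lower_central_series N k `<=` Z].
Proof.
elim: k Z => [|k IH] Z dZ nZ [r [g Hg]].
  exists Z; split=> //; exists [seq g i 0 | i : 'I_r] => x.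
  have [i Zi] := Hg (fun=> x); exists (g i 0) => //.
  by apply: map_f; rewrite mem_enum.
have [N1 [dN1 nN1 cN1 HN1]] := finite_index_centralizer (fun i => g i k.+1) dZ nZ.
have [|||N2 [dN2 nN2 cN2 HN2]] := IH (left_centralizer_mod Z N1).
- apply: definable_relP; apply: def_forall; apply: def_imply.
    by apply: def_mem => //; solve_map.
  by apply: def_mem => //; solve_map.
- exact: normal_left_centralizer_mod.
- exists r, g => a.
  pose c i := if insub i is Some j then
    iter_comm (fun l => (g (j : 'I_r) l)^-1 * a l) k else 1.
  have cE (i : 'I_r) : c i = iter_comm (fun l => (g i l)^-1 * a l) k.
    by rewrite /c valK.
  have [y|i] := HN1 c; last by rewrite cE; exists i.
  (* the last entry [y] is free while the others are fixed *)
  have [i Zi] := Hg (fun l => if l == k.+1 then y else a l).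
  exists i; rewrite cE; move: Zi; rewrite /= eqxx.
  rewrite (@eq_iter_comm _ _ (fun l => (g i l)^-1 * a l)) // => l lk.
  by rewrite ltn_eqF.
exists (N1 `&` N2); split.
- by apply: definable_relP; apply: def_and; apply: def_mem => //; solve_map.
- exact: normal_subgroupI.
- by apply: finitely_coversI => //; [case: nN1|case: nN2].
- move=> x Hx; apply: (Hx Z); split; first by case: nZ.
  move=> _ [u Hu [v [N1v _] <-]].
  by apply: (HN2 u) => //; apply: subset_lcs Hu => w [].
Qed.

End Nilpotent.

Lemma lower_central_series1 (G : groupType) (H : set G) c :
  H 1%g -> lower_central_series H c 1%g.
Proof. by case: c => // c _ K [[K1 _] _]. Qed.

Lemma normal_subgroup_trivial (G : groupType) : normal_subgroup [set 1%g : G].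
Proof.
split; first by split=> // x y -> ->; rewrite invg1 mulg1.
by move=> x g ->; apply: conj1g.
Qed.

Theorem theorem3 (L : language) (L_countable : countable_language L)
    (T : theory L) (T_complete : complete_theory T)
    (T_infinite : has_infinite_models T)
    (M : structure L) (M_model : model_of T M)
    (K : Type) (K_uncountable : ~ countable [set: K])
    (M_saturated : saturated K M)
    (k : nat) (k_ge1 : (1 <= k)%N)
    (G : definable_group M) (G_fsg : fsg K G)
    (w_generic : generic (commutator_fibre G k)) :
  exists N : set G,
    [/\ definable_subset N, normal_subgroup N, finite_index N &
        nilpotent_of_class_le (k - 1)%N N].
Proof.
case: k k_ge1 w_generic => // k _ [[s Hs] _].
have [|||N [dN nN cN Nk]] := nilpotent_mod (G := G) K_uncountable M_saturated
  G_fsg (k := k) (Z := [set 1%g]).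
- by apply: definable_relP; exact: (map_const 1%g).
- exact: normal_subgroup_trivial.
- exists (size s), (fun i j => nth 1%g s i (inord j)) => a.
  pose x : {ffun 'I_k.+1 -> G} := [ffun i : 'I_k.+1 => a i].
  have : [set: {ffun 'I_k.+1 -> G}] x by [].
  rewrite Hs => -[g gs [y Wy Ey]].
  have gi : (index g s < size s)%N by rewrite index_mem.
  exists (Ordinal gi); rewrite /= -Wy; apply/esym/left_normed_commutatorE => i.
  have := congr1 (fun f : {ffun 'I_k.+1 -> G} => f i) Ey.
  by rewrite !ffunE nth_index // inord_val => <-; rewrite mulKg.
exists N; rewrite subSS subn0; split=> //.
  by apply: finitely_covers_index => //; case: nN.
apply/seteqP; split=> // _ ->.
by apply: lower_central_series1; case: nN => -[].
Qed.
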